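(* Let $n\ge 1$ and $\lambda\in(0,n)$. The functional $\mathcal{E}_{\infty,\lambda}$ has a global minimizer in $\mathcal{P}$; that is, there exists $\mu\in\mathcal{P}$ such that $\mathcal{E}_{\infty,\lambda}(\mu)\le\mathcal{E}_{\infty,\lambda}(\nu)$ for all $\nu\in\mathcal{P}$.
   Context: $\mathcal{P}$ is the set of Borel measures $\mu$ on $\mathbb{R}^n$ with $\mu(\mathbb{R}^n)=1$. For $\mu\in\mathcal{P}$, $$\mathcal{E}_{\infty,\lambda}(\mu)=\begin{cases}\displaystyle\int_{\mathbb{R}^n}\int_{\mathbb{R}^n}|x-y|^{-\lambda}\,d\mu(x)\,d\mu(y) & \text{if } \operatorname{diam}(\operatorname{supp}\mu)\le 1,\\ +\infty & \text{otherwise,}\end{cases}$$ where $|x-y|^{-\lambda}=+\infty$ if $x=y$. *)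

(* Defs.v *)
From HB Require Import structures.
From mathcomp Require Import all_boot all_order all_algebra.
From mathcomp Require Import all_classical all_reals all_analysis.
Import Order.TTheory GRing.Theory Num.Theory numFieldNormedType.Exports.

Set Implicit Arguments.
Unset Strict Implicit.
Unset Printing Implicit Defensive.

Local Open Scope classical_set_scope.
Local Open Scope ring_scope.

(* The library topology on 'rV[R]_n is the product topology, which is the
   Euclidean one. *)
Definition borelRn (R : realType) (n : nat) : measurableType _ :=
  g_sigma_algebraType (@open 'rV[R]_n).

(* The library norm on 'rV[R]_n is the sup norm, hence the explicit Euclidean
   norm. *)
Definition enorm (R : realType) (n : nat) (x : 'rV[R]_n) : R :=
  Num.sqrt (\sum_(i < n) x ord0 i ^+ 2).

Definition supp (R : realType) (n : nat) (mu : probability (borelRn R n) R) :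
    set 'rV[R]_n :=
  [set x | forall U : set 'rV[R]_n, open U -> U x -> (0 < mu U)%E].

(* diam set0 = -oo; this case never occurs for the support of a Borel
   probability measure on R^n, which is nonempty. *)
Definition diam (R : realType) (n : nat) (A : set 'rV[R]_n) : \bar R :=
  ereal_sup [set (enorm (x - y))%:E | x in A & y in A].

(* The diagonal is treated separately because 0 `^ (- lambda) = 0 in the
   library. *)
Definition riesz_kernel (R : realType) (n : nat) (lambda : R)
    (x y : 'rV[R]_n) : \bar R :=
  if x == y then +oo%E else (enorm (x - y) `^ (- lambda))%:E.

Definition energy (R : realType) (n : nat) (lambda : R)
    (mu : probability (borelRn R n) R) : \bar R :=
  if (diam (supp mu) <= 1)%E
  then (\int[mu]_y \int[mu]_x riesz_kernel lambda x y)%E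
  else +oo%E.

(* Main.v *)
(* Let [nu_k] be a minimizing sequence and [x_k] a point of the support of
   [nu_k].  Points of the cube [x_k + [-2, 2[^n] are encoded by the interleaved
   binary digits of their coordinates, so that [nu_k] becomes a family of
   masses [f_k w] of dyadic cells indexed by finite binary words.  Along an
   ultrafilter these masses converge to some [m], which is still additive;
   cutting [0, 1] into nested intervals of lengths [m w] turns the uniform law
   on [0, 1] into a random digit sequence, hence a random point, whose law is
   the minimizer.  At each level, the least value of the kernel on a pair of
   cells, bounded below by [word_kernel], gives finite sums that pass to the
   limit, and Fatou's lemma then yields the bound on the energy.  The diameter
   bound survives because cells of positive limit mass contain points of the
   support of some [nu_k]. *)
From HB Require Import structures.
Require Import Defs.
From mathcomp Require Import all_boot all_order all_algebra.
From mathcomp Require Import all_classical all_reals all_analysis.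
From mathcomp Require Import measurable_realfun.
From mathcomp Require Import ring lra.
Import Order.TTheory GRing.Theory Num.Theory numFieldNormedType.Exports.

Set Implicit Arguments.
Unset Strict Implicit.
Unset Printing Implicit Defensive.

Local Open Scope classical_set_scope.
Local Open Scope ring_scope.

(** * Finite prefixes of digit sequences *)

Section words.

(* Words are stored newest letter first. *)
Definition word (b : nat -> bool) (j : nat) : seq bool := rev (mkseq b j).

(** Padding with [false] turns a finite word back into a digit sequence, to which [corner] can be
    applied. *)
Definition letter (w : seq bool) (i : nat) : bool := nth false (rev w) i.

Lemma wordS b j : word b j.+1 = b j :: word b j.
Proof. by rewrite /word mkseqS rev_rcons. Qed.

Lemma size_word b j : size (word b j) = j.
Proof. by rewrite size_rev size_mkseq. Qed.

Lemma letter_word b j i : (i < j)%N -> letter (word b j) i = b i.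
Proof. by move=> ij; rewrite /letter /word revK nth_mkseq. Qed.

Lemma measurable_word d (T : measurableType d) (b : T -> nat -> bool) :
  (forall j, measurable [set t | b t j]) ->
  forall j w, measurable [set t | word (b t) j = w].
Proof.
move=> mb; elim => [w|j ih [|c w]].
- rewrite (_ : [set t | _] = if w == [::] then setT else set0).
    by case: ifP.
  apply/seteqP; split => t /=; rewrite /word /=.
    by move=> <-; rewrite eqxx.
  by case: eqP => [->|].
- by rewrite (_ : [set t | _] = set0) // -subset0 => t /=; rewrite wordS.
- rewrite (_ : [set t | _] = [set t | word (b t) j = w] `&`
      (if c then [set t | b t j] else ~` [set t | b t j])).
    apply: measurableI; first exact: ih.
    by case: c => //; exact: measurableC.
  apply/seteqP; split => t /=; rewrite wordS.
    by move=> [<- <-]; split => //; case: ifPn => [//|/negP].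
  by move=> [<- h]; congr cons; case: c h => //= /negP/negbTE.
Qed.

End words.

(** * Random digits with prescribed word masses, from the uniform law *)

Section interval_tree.
Context (R : realType) (m : seq bool -> R).
Hypothesis m_ge0 : forall w, 0 <= m w.
Hypothesis m_nil : m [::] = 1.
Hypothesis m_cons : forall w, m (false :: w) + m (true :: w) = m w.

(* The word [w] labels the interval [left_end w, left_end w + m w[. *)
Fixpoint left_end (w : seq bool) : R :=
  if w is c :: v then left_end v + (if c then m (false :: v) else 0) else 0.

Fixpoint address (t : R) (j : nat) : seq bool :=
  if j is k.+1 then
    let w := address t k in (left_end w + m (false :: w) <= t) :: w
  else [::].

Definition code (t : R) (k : nat) : bool := head false (address t k.+1).

Lemma word_code t j : word (code t) j = address t j.
Proof. by elim: j => // j ih; rewrite wordS ih. Qed.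

(** The half-open intervals of the two children partition that of their parent. If the prefix is
    already wrong, both sides are false, since a child's interval lies inside its parent's. *)
Lemma addressE t w : 0 <= t < 1 ->
  (address t (size w) == w) = (left_end w <= t < left_end w + m w).
Proof.
move=> t01; elim: w => [|c v ih] /=; first by rewrite m_nil add0r t01.
rewrite eqseq_cons ih; have := m_cons v.
have := m_ge0 (false :: v); have := m_ge0 (true :: v).
have [av|nav] := eqVneq (address t (size v)) v.
  move: ih; rewrite av eqxx => /esym/andP[vt tv].
  move=> ? ? ?; case: c;
    rewrite ?addr0 vt tv ?eqb_id ?eqbF_neg -?ltNge/= ?andbT//.
  by apply/idP/idP => [?|/andP[]//]; apply/andP; split; lra.
rewrite -ih (negbTE nav) andbF => h1 h2 h3; apply/esym/negbTE/negP.
move=> h; have : left_end v <= t < left_end v + m v by case: c h; lra.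
by rewrite -ih (negbTE nav).
Qed.

Lemma left_end_bounds w : 0 <= left_end w /\ left_end w + m w <= 1.
Proof.
elim: w => [|c v [ih1 ih2]] /=; first by rewrite m_nil; split; lra.
have := m_cons v; have := m_ge0 (false :: v); have := m_ge0 (true :: v).
by case: c => *; split; lra.
Qed.

Lemma measurable_code j : measurable [set t | code t j].
Proof.
suff mw k w : measurable [set t | address t k = w].
  have -> : [set t | code t j] = \bigcup_(w in [set w | head false w])
      [set t | address t j.+1 = w].
    by apply/seteqP; split => t /=; [move=> tj; exists (address t j.+1)|
      move=> [w /= hw tw]; move: hw; rewrite -tw].
  rewrite bigcup_mkcond; apply: countable_bigcupT_measurable => // w.
  by case: ifP.
elim: k w => [|k ih] [|c v].
- by rewrite (_ : [set t | _] = setT) //; apply/seteqP; split.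
- by rewrite (_ : [set t | _] = set0) //; apply/seteqP; split.
- by rewrite (_ : [set t | _] = set0) //; apply/seteqP; split.
rewrite (_ : [set t | _] = [set t | address t k = v] `&`
  if c then [set` `[left_end v + m (false :: v), +oo[]
  else [set` `]-oo, left_end v + m (false :: v)[]).
  by apply: measurableI => //; case: (c).
apply/seteqP; split => t /=.
  move=> [<- <-]; split => //.
  by case: ifPn; rewrite /= in_itv/= ?andbT// ltNge.
move=> [-> h]; congr cons; case: c h; rewrite /= in_itv/= ?andbT //.
by rewrite ltNge => /negbTE.
Qed.

Local Notation P := (uniform_prob (@ltr01 R)).

Lemma uniform_prob_sub01 (A : set R) : measurable A -> A `<=` `[0, 1] ->
  P A = lebesgue_measure A.
Proof.
move=> mA A01; rewrite /uniform_prob.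
rewrite (eq_integral (fun=> 1%:E)) ?integral_cst ?mul1e//.
move=> x; rewrite inE => /A01 /=; rewrite in_itv/= /uniform_pdf => ->.
by rewrite subr0 invr1.
Qed.

(** On [[0, 1[] the event is an interval of length [m w], by [addressE]; the rest of the line is
    null for the uniform law and is split off first. *)
Lemma prob_word_code w : P [set t | word (code t) (size w) = w] = (m w)%:E.
Proof.
have mW : measurable [set t | word (code t) (size w) = w].
  exact: (measurable_word measurable_code).
pose I : set R := [set` `[0, 1[].
have mI : measurable I by exact: measurable_itv.
have PI : P I = 1%:E.
  rewrite uniform_prob_sub01//.
    by rewrite lebesgue_measure_itv/= lte_fin ltr01 sube0.
  by move=> x; rewrite /I /= !in_itv/= => /andP[-> /ltW ->].
have PCI : P (~` I) = 0%E.
  by rewrite probability_setC // [X in (_ - X)%E]PI subee.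
have [l0 l1] := left_end_bounds w.
have E : [set t | word (code t) (size w) = w] `&` I =
    [set` `[left_end w, left_end w + m w[].
  apply/seteqP; split => t; rewrite /I /= !in_itv /=.
    by move=> [tw t01]; rewrite -addressE // -word_code tw.
  move=> tw; have t01 : 0 <= t < 1 by lra.
  by split => //; apply/eqP; rewrite word_code addressE.
set W := [set t | _] in mW E *.
have PWC : P (W `&` ~` I) = 0%E.
  apply/eqP; rewrite eq_le measure_ge0 andbT -PCI le_measure// inE.
    by apply: measurableI => //; exact: measurableC.
  exact: measurableC.
have -> : P W = (P (W `&` I) + P (W `&` ~` I))%E.
  rewrite -measureU -?setIUr ?setUv ?setIT//.
  - exact: measurableI.
  - by apply: measurableI => //; exact: measurableC.
  - by rewrite -setIIr setICr setI0.
rewrite PWC adde0 E uniform_prob_sub01//.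
  rewrite lebesgue_measure_itv/= lte_fin; case: ifPn.
    by rewrite -EFinB => _; congr EFin; lra.
  by have := m_ge0 w; rewrite -leNgt => ? ?; congr EFin; lra.
by move=> x /=; rewrite !in_itv/=; lra.
Qed.

(** The half-open interval labelled by the word contains [t], so its length is positive. This holds
    for every [t] in [[0, 1[], not just almost every one. *)
Lemma m_code_gt0 t j : 0 <= t < 1 -> 0 < m (word (code t) j).
Proof.
move=> t01; have := addressE (word (code t) j) t01.
rewrite size_word -{1}word_code eqxx => /esym; lra.
Qed.

End interval_tree.

(** * Binary expansions of real numbers in [-2, 2[ *)

Section binary_expansion.
Context {R : realType}.
Implicit Types (b : nat -> bool) (u : R) (L : nat).

(** Side of a dyadic cell of level [L]. Starting from [[-2, 2[] leaves room for the closed range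
    [-1, 1] in a half-open interval. *)
Definition mesh L : R := 4 / 2 ^+ L.

Lemma mesh_gt0 L : 0 < mesh L.
Proof. by rewrite divr_gt0 // exprn_gt0. Qed.

Lemma mesh_double L : mesh L.+1 + mesh L.+1 = mesh L.
Proof.
rewrite /mesh exprS; have : (2 ^+ L : R) != 0 by rewrite expf_neq0.
by move=> ?; field.
Qed.

Lemma cvg_mesh : mesh @ \oo --> (0 : R).
Proof.
rewrite -(mulr0 4) /mesh; apply: cvgMr.
rewrite (_ : (fun L => _) = (fun L => (2^-1 : R) ^+ L)); last first.
  by apply/funext => L; rewrite exprVn.
by apply: cvg_expr; rewrite ger0_norm; lra.
Qed.

Fixpoint expansion b L : R :=
  if L is l.+1 then expansion b l + (if b l then mesh l.+1 else 0) else -2.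

Fixpoint truncation u L : R :=
  if L is l.+1 then
    let s := truncation u l in
    if s + mesh l.+1 <= u then s + mesh l.+1 else s
  else -2.

Definition digit u L : bool := truncation u L + mesh L.+1 <= u.

Lemma expansion_digit u L : expansion (digit u) L = truncation u L.
Proof. by elim: L => //= L ->; rewrite /digit; case: ifP; rewrite ?addr0. Qed.

Lemma expansion_digit_bounds u L : -2 <= u < 2 ->
  expansion (digit u) L <= u < expansion (digit u) L + mesh L.
Proof.
rewrite expansion_digit => u2; elim: L => [|L ih] /=.
  by rewrite /mesh expr0; lra.
by have := mesh_double L; case: (leP (truncation u L + _) u) => *; lra.
Qed.

Lemma eq_expansion b b' L : (forall l, (l < L)%N -> b l = b' l) ->
  expansion b L = expansion b' L.
Proof.
elim: L => //= L ih bb'; rewrite bb' // ih // => l lL.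
by apply: bb'; rewrite ltnS ltnW.
Qed.

Lemma expansion_nd b : {homo expansion b : L L' / (L <= L')%N >-> L <= L'}.
Proof.
apply: homo_leq => [//|y x z|L /=]; first exact: le_trans.
by rewrite lerDl; case: ifP => // _; exact/ltW/mesh_gt0.
Qed.

(** Right ends of nested cells decrease; the sign turns this into a statement about [<=] to which
    [homo_leq] applies. *)
Lemma expansion_upper_ni b :
  {homo (fun L => - (expansion b L + mesh L)) : L L' / (L <= L')%N >-> L <= L'}.
Proof.
apply: homo_leq => [//|y x z|L /=]; first exact: le_trans.
by have := mesh_double L; have := mesh_gt0 L.+1; case: ifP => _; lra.
Qed.

Lemma expansion_le b L L' : expansion b L' <= expansion b L + mesh L.
Proof.
have [LL'|/ltnW LL'] := leqP L L'.
  by have := expansion_upper_ni b LL'; have := mesh_gt0 L'; lra.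
by have := expansion_nd b LL'; have := mesh_gt0 L; lra.
Qed.

Definition expansion_lim b : R := limn (expansion b).

Lemma cvg_expansion b : expansion b @ \oo --> expansion_lim b.
Proof.
apply: nondecreasing_is_cvgn; first exact: expansion_nd.
by exists (expansion b 0 + mesh 0) => _ [L _ <-]; exact: expansion_le.
Qed.

(** The upper bound cannot be strict: digits that are all [true] from [L] on converge to the right
    end of the cell. *)
Lemma expansion_lim_bounds b L :
  expansion b L <= expansion_lim b <= expansion b L + mesh L.
Proof.
apply/andP; split.
  by apply: nondecreasing_cvgn_le; [exact: expansion_nd|exact: cvg_expansion].
apply: limr_le; first exact: cvg_expansion.
by near=> L'; exact: expansion_le.
Unshelve. all: by end_near. Qed.

Lemma measurable_digit L : measurable [set u | digit u L].
Proof.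
suff mt l : measurable_fun setT (truncation ^~ l).
  rewrite -[X in measurable X]setTI; apply: measurable_fun_ler => //.
  exact: measurable_funD.
elim: l => [|l ih] //=.
apply: measurable_fun_ifT => //; last exact: measurable_funD.
by apply: measurable_fun_ler => //; exact: measurable_funD.
Qed.

End binary_expansion.

(** * Countable base of the topology, Borel measurability and supports *)

Section rational_boxes.
Context {R : realType} {n : nat}.
Implicit Types (U : set 'rV[R]_n) (p x : 'rV[R]_n).

(** A base of the topology whose index type is countable, so that unions of boxes are countable
    unions. *)
Definition rat_box (c : 'rV[rat]_n * nat) : set 'rV[R]_n :=
  [set p | forall i, `|ratr (c.1 ord0 i) - p ord0 i| < c.2.+1%:R^-1].

Lemma open_rat_box U x : open U -> U x ->
  exists2 c, rat_box c x & rat_box c `<=` U.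
Proof.
move=> oU Ux; have /nbhs_ballP[e /= e0 xeU] : nbhs x U by exact: open_nbhs_nbhs.
(* The radius counts twice: once from [x] to the rational centre, once from the centre to a point of
   the box. *)
have [k ke] : exists k, k.+1%:R^-1 < e / 2.
  have [k _ /(_ k (leqnn k)) /=] :=
    near_infty_natSinv_lt (PosNum (divr_gt0 e0 (ltr0Sn R 1))).
  by exists k.
have rE i : exists q : rat, x ord0 i < ratr q < x ord0 i + k.+1%:R^-1.
  have [|q] := @rat_in_itvoo R (x ord0 i) (x ord0 i + k.+1%:R^-1).
    by rewrite ltrDl invr_gt0.
  by rewrite in_itv/=; exists q.
have [q qP] := choice rE.
exists (\row_i q i, k) => /=.
  move=> i; rewrite mxE /=; move: (qP i) ke; set r := _^-1 => ? ?.
  by rewrite ger0_norm; lra.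
move=> p /= qp; apply: xeU; split => // j i; rewrite (ord1 j).
have := qp i; rewrite /= mxE /ball /=.
move: (qP i) ke; set r := _^-1; rewrite !ltr_norml => ? ? ?; lra.
Qed.

Lemma measurable_open U : open U -> measurable (U : set (borelRn R n)).
Proof. by move=> oU; exact: sub_sigma_algebra. Qed.

Lemma continuous_measurable_borelRn (f : 'rV[R]_n -> R) : continuous f ->
  measurable_fun [set: borelRn R n] f.
Proof.
move=> cf; apply: (measurability _ (RGenOInfty.measurableE R)) => //.
move=> _ [_ [a ->] <-]; rewrite setTI; apply: measurable_open.
apply: open_comp => [? _|]; first exact: cf.
by rewrite set_itvE; exact: open_gt.
Qed.

Lemma measurable_coord i :
  measurable_fun [set: borelRn R n] (fun p => (p : 'rV[R]_n) ord0 i).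
Proof.
apply: (continuous_measurable_borelRn (f := fun p => p ord0 i)).
exact: coord_continuous.
Qed.

Lemma measurable_preimage_rat_box d (T : measurableType d)
    (X : T -> 'rV[R]_n) c :
  (forall i, measurable_fun setT (fun t => X t ord0 i)) ->
  measurable (X @^-1` rat_box c).
Proof.
move=> mX; rewrite (_ : X @^-1` rat_box c = \bigcap_(i in [set: 'I_n])
    [set t | `|ratr (c.1 ord0 i) - X t ord0 i| < c.2.+1%:R^-1]).
  apply: fin_bigcap_measurable => // i _.
  rewrite -[X in measurable X]setTI; apply: measurable_fun_ltr => //.
  by apply: measurableT_comp => //; exact: measurable_funB.
apply/seteqP; split => t /=; first by move=> h i _; exact: h.
by move=> h i; exact: h.
Qed.

(** Open sets generate the sigma-algebra, and each is a countable union of rational boxes, whose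
    preimages only involve coordinates. *)
Lemma measurable_fun_borelRn d (T : measurableType d) (X : T -> borelRn R n) :
  (forall i, measurable_fun setT (fun t => (X t : 'rV[R]_n) ord0 i)) ->
  measurable_fun setT X.
Proof.
move=> mX.
apply: (@measurability _ _ _ (borelRn R n) _ _ (@open 'rV[R]_n)) => //.
move=> _ [U oU <-]; rewrite setTI.
rewrite (_ : X @^-1` U = \bigcup_(c in [set c | rat_box c `<=` U])
   (X @^-1` rat_box c)).
  rewrite bigcup_mkcond; apply: countable_bigcupT_measurable => // c.
  by case: ifP => // _; exact: measurable_preimage_rat_box.
apply/seteqP; split => t /=; last by move=> [c cU /cU].
by move=> /(open_rat_box oU)[c]; exists c.
Qed.

Lemma closed_supp (mu : probability (borelRn R n) R) : closed (supp mu).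
Proof.
rewrite -[supp mu]setCK; apply: open_closedC; rewrite openE => x.
move/existsNP => [U /not_implyP[oU /not_implyP[Ux muU]]].
apply: filterS (open_nbhs_nbhs (conj oU Ux)) => y Uy.
by move=> /(_ U oU Uy).
Qed.

(** A point off the support has a null open neighbourhood, hence lies in a null rational box, and
    there are countably many of these. *)
Lemma supp_conull (mu : probability (borelRn R n) R) : mu (~` supp mu) = 0%E.
Proof.
have mS : measurable (~` supp mu : set (borelRn R n)).
  by apply: measurable_open; exact/closed_openC/closed_supp.
have mB c : measurable (rat_box c : set (borelRn R n)).
  apply: (@measurable_preimage_rat_box _ (borelRn R n) idfun) => i.
  exact: measurable_coord.
pose F k : set (borelRn R n) := if unpickle k is Some c then
  if mu (rat_box c) == 0%E then rat_box c else set0 else set0.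
apply/negligibleP => //; apply: (@negligibleS _ _ _ mu (\bigcup_k F k)).
  move=> x /existsNP[U /not_implyP[oU /not_implyP[Ux /negP muU]]].
  have [c cx cU] := open_rat_box oU Ux.
  exists (pickle c) => //; rewrite /F pickleK ifT//.
  rewrite eq_le measure_ge0 andbT.
  apply: (@le_trans _ _ (mu U)); last by rewrite leNgt.
  by apply: le_measure; rewrite ?inE //; exact: measurable_open.
apply: negligible_bigcup => k; rewrite /F.
case: unpickle => [c|]; last exact: negligible_set0.
case: ifPn => [/eqP c0|_]; last exact: negligible_set0.
exact/negligibleP.
Qed.

Lemma meets_supp (mu : probability (borelRn R n) R) (A : set (borelRn R n)) :
  measurable A -> (0 < mu A)%E -> exists2 p, A p & supp mu p.
Proof.
move=> mA muA; apply: contrapT => /forall2NP h.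
have : (mu A <= mu (~` supp mu))%E.
  apply: le_measure; rewrite ?inE //.
    by apply: measurable_open; exact/closed_openC/closed_supp.
  by move=> p Ap; case: (h p).
by rewrite supp_conull leNgt muA.
Qed.

Lemma supp_nonempty (mu : probability (borelRn R n) R) : supp mu !=set0.
Proof.
have [||p _ ?] := @meets_supp mu setT; [exact: measurableT| |by exists p].
by rewrite probability_setT.
Qed.

End rational_boxes.

(** * Interleaving the digits of the coordinates *)

Section interleaving.
Context {R : realType} {n : nat}.
Implicit Types (b : nat -> bool) (x p : 'rV[R]_n.+1) (L : nat).

Definition strand b (i : nat) : nat -> bool := fun l => b (l * n.+1 + i)%N.

Definition corner b L : 'rV[R]_n.+1 := \row_i expansion (strand b i) L.

Definition point b : 'rV[R]_n.+1 := \row_i expansion_lim (strand b i).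

(** Words of length [L * n.+1] carry exactly [L] digits of each coordinate, which is why only these
    lengths occur later. *)
Lemma eq_corner b b' L : (forall j, (j < L * n.+1)%N -> b j = b' j) ->
  corner b L = corner b' L.
Proof.
move=> bb'; apply/rowP => i; rewrite !mxE; apply: eq_expansion => l lL.
apply: bb'; apply: (@leq_trans (l.+1 * n.+1)%N); last first.
  by rewrite leq_mul2r lL orbT.
by rewrite mulSn addnC ltn_add2r.
Qed.

Lemma corner_letter b L : corner (letter (word b (L * n.+1))) L = corner b L.
Proof. by apply: eq_corner => j jL; exact: letter_word. Qed.

Lemma corner_point b L i :
  `|corner b L ord0 i - point b ord0 i| <= mesh L.
Proof.
rewrite !mxE ler_norml; have := @expansion_lim_bounds R (strand b i) L.
by move: (mesh_gt0 (R := R) L) => *; lra.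
Qed.

(** Recentring at [x] brings every measure of a minimizing sequence into the same cube, even if the
    supports drift to infinity. *)
Definition vdigit x p : nat -> bool :=
  fun j => digit ((p - x) ord0 (inord (j %% n.+1))) (j %/ n.+1).

Lemma strand_vdigit x p (i : 'I_n.+1) :
  strand (vdigit x p) i = digit ((p - x) ord0 i).
Proof.
by apply/funext => l; rewrite /strand /vdigit modnMDl modn_small// inord_val
  divnMDl// divn_small// addn0.
Qed.

Lemma corner_vdigit x p L : (forall i, `|(p - x) ord0 i| <= 1) ->
  forall i, `|corner (vdigit x p) L ord0 i - (p - x) ord0 i| <= mesh L.
Proof.
move=> px i; rewrite {1}mxE strand_vdigit ler_norml.
have := px i; rewrite ler_norml; set u := (p - x) ord0 i => ?.
have : -2 <= u < 2 by lra.
by move=> /(expansion_digit_bounds L); move: (mesh_gt0 (R := R) L) => *; lra.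
Qed.

Lemma measurable_vdigit x j :
  measurable [set p : borelRn R n.+1 | vdigit x p j].
Proof.
set i : 'I_n.+1 := inord (j %% n.+1).
have mi : measurable_fun [set: borelRn R n.+1] (fun p => (p - x) ord0 i).
  under eq_fun do rewrite !mxE.
  by apply: measurable_funB => //; exact: measurable_coord.
rewrite -[X in measurable X]setTI.
exact: (mi measurableT _ (measurable_digit _)).
Qed.

End interleaving.

(** * The Euclidean norm and its stability under coordinate errors *)

Section euclidean_norm.
Context {R : realType} {n : nat}.
Implicit Types (x y : 'rV[R]_n) (h : R).

Lemma enorm_ge0 x : 0 <= enorm x.
Proof. exact: sqrtr_ge0. Qed.

Lemma enorm_eq0 x : (enorm x == 0) = (x == 0).
Proof.
rewrite sqrtr_eq0; apply/idP/eqP => [h|->]; last first.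
  by rewrite big1 // => i _; rewrite mxE expr0n.
apply/rowP => i; rewrite mxE; apply/eqP; rewrite -sqrf_eq0 eq_le sqr_ge0 andbT.
apply: le_trans h; rewrite (bigD1 i)//= lerDl.
by apply: sumr_ge0 => j _; exact: sqr_ge0.
Qed.

Lemma ler_coord_enorm x i : `|x ord0 i| <= enorm x.
Proof.
rewrite -sqrtr_sqr ler_wsqrtr// (bigD1 i)//= lerDl.
by apply: sumr_ge0 => j _; exact: sqr_ge0.
Qed.

Lemma cvg_enorm T (F : set_system T) (FF : Filter F) (f : T -> 'rV[R]_n) x :
  (forall i, f t ord0 i @[t --> F] --> x ord0 i) ->
  enorm (f t) @[t --> F] --> enorm x.
Proof.
move=> fx; apply: (continuous_cvg _ (@sqrt_continuous R _)).
apply: (cvg_big (@add_continuous R)) => i _.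
by rewrite expr2; under eq_fun do rewrite expr2; exact: cvgM.
Qed.

Lemma continuous_enormB x : continuous (fun z : 'rV[R]_n => enorm (z - x)).
Proof.
move=> z; apply: (@cvg_enorm _ (nbhs z) _ (fun z => z - x) (z - x)) => i.
rewrite !mxE; under eq_cvg do rewrite !mxE.
by apply: cvgB; [exact: coord_continuous|exact: cvg_cst].
Qed.

(* The largest norm of a vector whose coordinates are within [h] of those of
   [x]. *)
Definition enorm_infl x h : R := Num.sqrt (\sum_(i < n) (`|x ord0 i| + h) ^+ 2).

Lemma enorm_le_infl x y h : 0 <= h -> (forall i, `|x ord0 i - y ord0 i| <= h) ->
  enorm y <= enorm_infl x h.
Proof.
move=> h0 xy; apply: ler_wsqrtr; apply: ler_sum => i _.
rewrite -[leLHS]real_normK ?num_real// ler_pXn2r ?nnegrE ?addr_ge0//.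
by rewrite -lerBlDl (le_trans (lerB_dist _ _))// distrC.
Qed.

(** Keeps the finite-level kernels away from radius 0, where a negative power takes the default
    value 0. *)
Lemma enorm_infl_gt0 x h : (0 < n)%N -> 0 < h -> 0 < enorm_infl x h.
Proof.
move=> n0 h0; rewrite sqrtr_gt0 (bigD1 (Ordinal n0))//=.
apply: ltr_wpDr; first by apply: sumr_ge0 => j _; exact: sqr_ge0.
by rewrite exprn_gt0// ltr_wpDl.
Qed.

Lemma cvg_enorm_infl (x_ : nat -> 'rV[R]_n) (h_ : nat -> R) x :
  (forall i, x_ k ord0 i @[k --> \oo] --> x ord0 i) -> h_ @ \oo --> (0 : R) ->
  enorm_infl (x_ k) (h_ k) @[k --> \oo] --> enorm x.
Proof.
(* Both sides become norms of rows of inflated absolute values, so that [cvg_enorm] applies. *)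
move=> xx h0; have -> : enorm x = enorm (\row_i (`|x ord0 i| + 0)).
  congr Num.sqrt; apply: eq_bigr => i _.
  by rewrite mxE addr0 real_normK// num_real.
have -> : (fun k => enorm_infl (x_ k) (h_ k)) =
    (fun k => enorm (\row_i (`|x_ k ord0 i| + h_ k))).
  by apply/funext => k; congr Num.sqrt; apply: eq_bigr => i _; rewrite mxE.
apply: cvg_enorm => i; rewrite mxE; under eq_fun do rewrite mxE.
by apply: cvgD => //; exact: cvg_norm.
Qed.

End euclidean_norm.

(** * The Riesz kernel as a function of the distance *)

Section radial_kernel.
Context {R : realType} (lambda : R) (lambda_gt0 : 0 < lambda).

Definition radial (r : R) : \bar R :=
  if r == 0 then +oo%E else (r `^ (- lambda))%:E.

Lemma riesz_kernelE n (x y : 'rV[R]_n) :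
  riesz_kernel lambda x y = radial (enorm (x - y)).
Proof. by rewrite /riesz_kernel /radial enorm_eq0 subr_eq0. Qed.

Lemma radial_ge0 r : (0 <= radial r)%E.
Proof.
by rewrite /radial; case: ifP => _; rewrite ?leey// lee_fin powR_ge0.
Qed.

Lemma powRN_ni (a b : R) :
  0 < a -> a <= b -> b `^ (- lambda) <= a `^ (- lambda).
Proof.
move=> a0 ab; have b0 : 0 < b by exact: lt_le_trans ab.
rewrite !powRN lef_pV2 ?posrE ?powR_gt0//.
by apply: (ge0_ler_powR (ltW lambda_gt0)) => //; rewrite nnegrE ltW.
Qed.

Lemma radial_ge (r s : R) : 0 <= r -> r <= s ->
  ((s `^ (- lambda))%:E <= radial r)%E.
Proof.
move=> r0 rs; rewrite /radial; case: eqVneq => [_|rn0]; first exact: leey.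
by rewrite lee_fin; apply: powRN_ni => //; rewrite lt_def rn0.
Qed.

(** For [r > 0] this is continuity of the power; for [r = 0] the powers eventually exceed every
    bound. *)
Lemma cvg_radial (u : nat -> R) (r : R) : (forall k, 0 < u k) ->
  u @ \oo --> r -> 0 <= r ->
  ((u k `^ (- lambda))%:E)%E @[k --> \oo] --> radial r.
Proof.
move=> u0 ur r0; rewrite /radial; case: eqVneq => [r00|rn0].
  apply/cvgeyPge => A; pose B := Num.max A 1.
  have B0 : 0 < B by rewrite lt_max ltr01 orbT.
  (* The radius at which the power equals [B]; taking [B] at least 1 makes it positive. *)
  pose d := B `^ (- lambda^-1); have d0 : 0 < d by exact: powR_gt0.
  near=> k; rewrite lee_fin (@le_trans _ _ B)// ?le_max ?lexx//.
  have -> : B = d `^ (- lambda).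
    by rewrite /d -powRrM mulrNN mulVf ?gt_eqF// powRr1// ltW.
  apply: powRN_ni => //; near: k; move: ur; rewrite r00 => /cvgr0_norm_le.
  move=> /(_ _ d0); apply: filterS => k; apply: le_trans; exact: ler_norm.
apply: cvg_EFin; first by near=> k.
have pc : {for r, continuous (fun a => a `^ (- lambda))}.
  apply/differentiable_continuous/derivable1_diffP/derivable_powR.
  by rewrite in_itv/= andbT lt_def rn0.
exact: (continuous_cvg _ pc ur).
Unshelve. all: by end_near. Qed.

Lemma measurable_radial : measurable_fun setT radial.
Proof.
apply: measurable_fun_ifT => //; first exact: measurable_fun_eqr.
by apply/measurable_EFinP; exact: measurable_powR.
Qed.

Lemma measurable_riesz_kernel n :
  measurable_fun [set: borelRn R n * borelRn R n]
    (fun z => riesz_kernel lambda z.1 z.2).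
Proof.
under eq_fun do rewrite riesz_kernelE.
apply: (measurableT_comp measurable_radial).
have msqrt : measurable_fun setT (@Num.sqrt R).
  by apply: continuous_measurable_fun; exact: sqrt_continuous.
apply: (measurableT_comp msqrt).
apply: measurable_sum => i.
under eq_fun do rewrite !mxE.
apply: measurable_funX; apply: measurable_funB.
  exact: (measurableT_comp (measurable_coord i) measurable_fst).
exact: (measurableT_comp (measurable_coord i) measurable_snd).
Qed.

End radial_kernel.

(** * Integrals of functions of a random word *)

Section word_integrals.
Context {R : realType} d (T : measurableType d) (P : probability T R).
Context (b : T -> nat -> bool) (J : nat) (m : seq bool -> R).
Hypothesis mb : forall j, measurable [set t | b t j].
Hypothesis bm : forall w, size w = J -> P [set t | word (b t) J = w] = (m w)%:E.

Lemma measurable_fun_word (F : seq bool -> \bar R) :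
  measurable_fun setT (fun t => F (word (b t) J)).
Proof.
move=> _ B mB; rewrite setTI.
rewrite (_ : _ @^-1` B = \bigcup_(w in [set w | B (F w)])
    [set t | word (b t) J = w]).
  rewrite bigcup_mkcond; apply: countable_bigcupT_measurable => // w.
  by case: ifP => // _; exact: measurable_word.
apply/seteqP; split => t /=; first by exists (word (b t) J).
by move=> [w /= Bw ->].
Qed.

(** The integrand is a simple function: at each [t] exactly one word event of length [J] occurs. *)
Lemma integral_word (F : seq bool -> R) : (forall w, 0 <= F w) ->
  (\int[P]_t (F (word (b t) J))%:E = (\sum_(w : J.-tuple bool) F w * m w)%:E)%E.
Proof.
move=> F0; have mW w : measurable [set t | word (b t) J = w].
  exact: measurable_word.
transitivity (\int[P]_t
    \sum_(w : J.-tuple bool) (F w)%:E * (\1_[set t | word (b t) J = w] t)%:E)%E.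
  apply: eq_integral => t _; have /eqP sw := size_word (b t) J.
  rewrite (bigD1 (Tuple sw))//= indicE mem_set// mule1 big1 ?adde0// => w wN.
  rewrite indicE memNset ?mule0//= => wE; case/negP: wN.
  by apply/eqP/val_inj; rewrite /= wE.
rewrite ge0_integral_sum//=; last 2 first.
- move=> w; apply: measurable_funeM; apply/measurable_EFinP.
  exact: measurable_indic.
- by move=> w t _; rewrite mule_ge0 ?lee_fin.
rewrite -sumEFin; apply: eq_bigr => w _.
rewrite ge0_integralZl//=; last 2 first.
- by apply/measurable_EFinP; exact: measurable_indic.
- by rewrite lee_fin.
rewrite integral_indic// setIT EFinM; congr (_ * _)%E.
by apply: bm; rewrite size_tuple.
Qed.

End word_integrals.

(** * Discrete energies *)

Section word_energy.
Context {R : realType}.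

(** A polynomial in finitely many masses, hence continuous under convergence of each mass. *)
Definition word_energy (J : nat) (K : seq bool -> seq bool -> R)
    (m : seq bool -> R) : R :=
  \sum_(v : J.-tuple bool) (\sum_(w : J.-tuple bool) K w v * m w) * m v.

(** Serves both for the digits of points under a given measure and for [code] under the uniform
    law. *)
Lemma integral2_word d (T : measurableType d) (P : probability T R)
    (b : T -> nat -> bool) J (m : seq bool -> R)
    (K : seq bool -> seq bool -> R) :
  (forall j, measurable [set t | b t j]) ->
  (forall w, size w = J -> P [set t | word (b t) J = w] = (m w)%:E) ->
  (forall w v, 0 <= K w v) ->
  (\int[P]_s \int[P]_t (K (word (b t) J) (word (b s) J))%:E =
  (word_energy J K m)%:E)%E.
Proof.
move=> mb bm K0.
transitivity (\int[P]_s (\sum_(w : J.-tuple bool)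
    K w (word (b s) J) * m w)%:E)%E.
  apply: eq_integral => s _.
  exact: (integral_word (F := fun w => K w (word (b s) J)) mb bm).
rewrite (integral_word
  (F := fun v => \sum_(w : J.-tuple bool) K w v * m w) mb bm)//.
move=> v; apply: sumr_ge0 => w _; apply: mulr_ge0 => //.
by rewrite -lee_fin -bm ?measure_ge0// size_tuple.
Qed.

End word_energy.

(** * Limits along an ultrafilter *)

Section ultralimits.
Context {R : realType}.

(** One ultrafilter makes all the bounded sequences converge simultaneously, in place of a diagonal
    extraction. *)
Lemma ultralimit I (f : nat -> I -> R) : (forall k i, 0 <= f k i <= 1) ->
  exists (G : set_system nat) (m : I -> R),
    [/\ ProperFilter G, \oo `<=` G & forall i, f k i @[k --> G] --> m i].
Proof.
move=> f01; have [G [GU ooG]] := @ultraFilterLemma _ (\oo : set_system nat) _.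
suff /choice[m fm] : forall i, exists l : R, f k i @[k --> G] --> l.
  by exists G, m; split => //; exact: ultra_proper.
move=> i; have f01G : (f k i @[k --> G]) [set` `[0, 1]].
  by apply: ooG; exists 0%N => // k _ /=; rewrite in_itv/=.
have [l [_ fl]] := @segment_compact R 0 1 (f k i @[k --> G]) _ f01G.
(* A cluster point of an ultrafilter is a limit: otherwise the complement of [B] would be in the
   image filter and would have to meet [B]. *)
exists l => B lB; have [//|GnB] := in_ultra_setVsetC ((f ^~ i) @^-1` B) GU.
by have [r [nBr Br]] := fl (~` B) B GnB lB.
Qed.

Lemma ultralimit_le (G : set_system nat) (u : nat -> R) l a : ProperFilter G ->
  \oo `<=` G -> u @ G --> l -> (\forall k \near \oo, u k <= a) -> l <= a.
Proof.
move=> GG ooG ul ua; apply: (@closed_cvg _ _ _ GG u [set r | r <= a]) ul => //.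
exact: ooG.
Qed.

End ultralimits.

(** * Cell masses and the comparison of discrete with continuous energy *)

Section discretization.
Context {R : realType} {n : nat} (lambda : R) (lambda_gt0 : 0 < lambda).
Implicit Types (nu : probability (borelRn R n.+1) R) (x p q : 'rV[R]_n.+1).

(** Each point is within one mesh of its corner in every coordinate, so differences are within
    two. *)
Definition word_kernel L (w v : seq bool) : R :=
  enorm_infl (corner (letter w) L - corner (letter v) L : 'rV[R]_n.+1)
    (mesh L + mesh L) `^ (- lambda).

Definition cell_mass nu x (w : seq bool) : R :=
  fine (nu [set p | word (vdigit x p) (size w) = w]).

Lemma measurable_cell x j w :
  measurable [set p : borelRn R n.+1 | word (vdigit x p) j = w].
Proof.
apply: (@measurable_word _ (borelRn R n.+1) (vdigit x)) => k.
exact: measurable_vdigit.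
Qed.

Lemma cell_massE nu x w :
  nu [set p | word (vdigit x p) (size w) = w] = (cell_mass nu x w)%:E.
Proof. by rewrite fineK// fin_num_measure//; exact: measurable_cell. Qed.

Lemma cell_mass_bounds nu x w : 0 <= cell_mass nu x w <= 1.
Proof.
rewrite -!lee_fin -cell_massE measure_ge0/=.
by apply: probability_le1; exact: measurable_cell.
Qed.

Lemma cell_mass_nil nu x : cell_mass nu x [::] = 1.
Proof.
apply: EFin_inj; rewrite -cell_massE -[RHS](probability_setT nu).
by congr (nu _); apply/seteqP; split.
Qed.

Lemma cell_mass_cons nu x w :
  cell_mass nu x (false :: w) + cell_mass nu x (true :: w) = cell_mass nu x w.
Proof.
apply: EFin_inj; rewrite EFinD -!cell_massE -measureU//=.
- congr (nu _); apply/seteqP; split => p /=; rewrite wordS.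
    by move=> [[_ ->]|[_ ->]].
  by move=> ->; case: (vdigit x p _); [right|left].
- exact: measurable_cell.
- exact: measurable_cell.
- by rewrite -subset0 => p [/= ]; rewrite wordS => -[-> _] [].
Qed.

Lemma enorm_supp nu p q : (diam (supp nu) <= 1)%E -> supp nu p -> supp nu q ->
  enorm (p - q) <= 1.
Proof.
move=> nu1 pnu qnu; rewrite -lee_fin; apply: le_trans nu1.
by apply: ereal_sup_ubound; exists p => //; exists q.
Qed.

Lemma coord_supp nu p q : (diam (supp nu) <= 1)%E -> supp nu p -> supp nu q ->
  forall i, `|(p - q) ord0 i| <= 1.
Proof.
move=> nu1 pnu qnu i.
exact: le_trans (ler_coord_enorm _ _) (enorm_supp nu1 pnu qnu).
Qed.

Lemma corner_vdigitB x p q L : (forall i, `|(p - x) ord0 i| <= 1) ->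
  (forall i, `|(q - x) ord0 i| <= 1) -> forall i,
  `|(corner (vdigit x p) L - corner (vdigit x q) L) ord0 i - (p - q) ord0 i|
    <= mesh L + mesh L.
Proof.
move=> px qx i; have := corner_vdigit L px i; have := corner_vdigit L qx i.
set c : 'rV[R]_n.+1 := corner _ _; set c' : 'rV[R]_n.+1 := corner _ _.
by rewrite !mxE !ler_norml => ? ?; lra.
Qed.

(** The inflated norm of the corner difference dominates the distance from [p] to [q], and the
    kernel decreases with distance. *)
Lemma word_kernel_le x p q L : (forall i, `|(p - x) ord0 i| <= 1) ->
  (forall i, `|(q - x) ord0 i| <= 1) ->
  ((word_kernel L (word (vdigit x p) (L * n.+1))
     (word (vdigit x q) (L * n.+1)))%:E <= riesz_kernel lambda p q)%E.
Proof.
move=> px qx; rewrite riesz_kernelE /word_kernel !corner_letter.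
apply: radial_ge => //; first exact: enorm_ge0.
apply: enorm_le_infl; last exact: corner_vdigitB.
by rewrite addr_ge0// ltW// mesh_gt0.
Qed.

Lemma word_kernel_ge0 L w v : 0 <= word_kernel L w v.
Proof. exact: powR_ge0. Qed.

Lemma riesz_kernel_ge0 (p q : 'rV[R]_n.+1) : (0 <= riesz_kernel lambda p q)%E.
Proof. by rewrite riesz_kernelE radial_ge0. Qed.

Lemma measurable_riesz_kernel_l q :
  measurable_fun [set: borelRn R n.+1] (fun p => riesz_kernel lambda p q).
Proof.
exact: (measurableT_comp (@measurable_riesz_kernel R lambda n.+1)
  (@pair2_measurable _ _ (borelRn R n.+1) (borelRn R n.+1) q)).
Qed.

Lemma measurable_potential nu :
  measurable_fun [set: borelRn R n.+1]
    (fun q => \int[nu]_p riesz_kernel lambda p q)%E.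
Proof.
apply: (@measurable_fun_fubini_tonelli_G _ _ (borelRn R n.+1) (borelRn R n.+1)
  _ nu (fun z => riesz_kernel lambda z.1 z.2)).
  exact: measurable_riesz_kernel.
by move=> z; exact: riesz_kernel_ge0.
Qed.

Lemma ae_supp nu (Q : 'rV[R]_n.+1 -> Prop) : (forall p, supp nu p -> Q p) ->
  {ae nu, forall p, [set: borelRn R n.+1] p -> Q p}.
Proof.
move=> h; exists (~` supp nu); split.
- by apply: measurable_open; exact/closed_openC/closed_supp.
- exact: supp_conull.
- by move=> p /= /not_implyP[_ nQ] /h.
Qed.

(** Points of the support are within 1 of [x], so [word_kernel_le] holds almost everywhere in each
    variable. *)
Lemma word_energy_le nu x L : (diam (supp nu) <= 1)%E -> supp nu x ->
  ((word_energy (L * n.+1) (word_kernel L) (cell_mass nu x))%:E <=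
   \int[nu]_q \int[nu]_p riesz_kernel lambda p q)%E.
Proof.
move=> nu1 xnu; set J := (L * n.+1)%N.
have mb j : measurable [set p : borelRn R n.+1 | vdigit x p j].
  exact: measurable_vdigit.
have bm w : size w = J ->
    nu [set p | word (vdigit x p) J = w] = (cell_mass nu x w)%:E.
  by move=> <-; exact: cell_massE.
rewrite -(integral2_word mb bm (word_kernel_ge0 L)).
have mI v : measurable_fun [set: borelRn R n.+1]
    (fun p => (word_kernel L (word (vdigit x p) J) v)%:E).
  exact: (measurable_fun_word _ mb (fun w => (word_kernel L w v)%:E)).
apply: ae_ge0_le_integral => //.
- move=> q _; apply: integral_ge0 => p _.
  by rewrite lee_fin word_kernel_ge0.
- exact: (measurable_fun_word _ mb
    (fun v => \int[nu]_p (word_kernel L (word (vdigit x p) J) v)%:E)%E).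
- by move=> q _; apply: integral_ge0 => p _; exact: riesz_kernel_ge0.
- exact: measurable_potential.
apply: ae_supp => q qnu; apply: ae_ge0_le_integral => //.
- by move=> p _; rewrite lee_fin word_kernel_ge0.
- by move=> p _; exact: riesz_kernel_ge0.
- exact: measurable_riesz_kernel_l.
apply: ae_supp => p pnu; apply: word_kernel_le; exact: coord_supp nu1 _ xnu.
Qed.

Lemma cell_meets_supp nu x w : 0 < cell_mass nu x w ->
  exists2 p, word (vdigit x p) (size w) = w & supp nu p.
Proof.
rewrite -lte_fin -cell_massE => /meets_supp; apply.
exact: measurable_cell.
Qed.

End discretization.

(** * Construction of the limit measure from its cell masses *)

Section limit_law.
Context {R : realType} {n : nat} (lambda : R) (lambda_gt0 : 0 < lambda).

Lemma measurable_point d (T : measurableType d) (b : T -> nat -> bool) :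
  (forall j, measurable [set t | b t j]) ->
  measurable_fun setT (fun t => point (b t) : borelRn R n.+1).
Proof.
move=> mb; apply: measurable_fun_borelRn => i.
under eq_fun do rewrite mxE.
apply: (measurable_fun_cvg
  (h := fun L t => expansion (strand (n := n) (b t) i) L)).
  elim=> [|L ih] //=; apply: measurable_funD => //.
  apply: measurable_fun_ifT => //; apply: (measurable_fun_bool true).
  rewrite setTI; exact: mb.
by move=> t _; exact: cvg_expansion.
Qed.

(** Corners tend to points and meshes to 0. Coinciding points are included, the limit then being
    infinite. *)
Lemma cvg_word_kernel (b b' : nat -> bool) :
  ((word_kernel (n := n) lambda L (word b (L * n.+1)) (word b' (L * n.+1)))%:E
    @[L --> \oo] --> riesz_kernel lambda (point b : 'rV[R]_n.+1) (point b'))%E.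
Proof.
rewrite riesz_kernelE.
under eq_fun do rewrite /word_kernel !corner_letter.
apply: cvg_radial => //; last exact: enorm_ge0.
  by move=> L; apply: enorm_infl_gt0 => //; rewrite addr_gt0// mesh_gt0.
apply: cvg_enorm_infl.
  move=> i; rewrite !mxE; under eq_fun do rewrite !mxE.
  by apply: cvgB; exact: cvg_expansion.
by rewrite -[X in _ --> X](addr0 0); apply: cvgD; exact: cvg_mesh.
Qed.

(** The last two hypotheses are the finite-level forms of the energy bound and of the diameter
    bound; [mu] is the law of [point (code m t)] for uniform [t]. *)
Lemma limit_law (m : seq bool -> R) (e : R) :
  (forall w, 0 <= m w) -> m [::] = 1 ->
  (forall w, m (false :: w) + m (true :: w) = m w) ->
  (forall L, word_energy (L * n.+1) (word_kernel (n := n) lambda L) m <= e) ->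
  (forall L w v, 0 < m w -> 0 < m v -> size w = (L * n.+1)%N ->
    size v = (L * n.+1)%N ->
    exists2 z : 'rV[R]_n.+1, enorm z <= 1 & forall i,
      `|(corner (letter w) L - corner (letter v) L) ord0 i - z ord0 i|
        <= mesh L + mesh L) ->
  exists2 mu : probability (borelRn R n.+1) R, (diam (supp mu) <= 1)%E &
    (\int[mu]_q \int[mu]_p riesz_kernel lambda p q <= e%:E)%E.
Proof.
move=> m0 m1 mD me mz.
pose P : probability (measurableTypeR R) R := uniform_prob (@ltr01 R).
pose X (t : measurableTypeR R) : borelRn R n.+1 := point (code m t).
have mX : measurable_fun setT X.
  by apply: measurable_point; exact: measurable_code.
pose mX_mixin := isMeasurableFun.Build _ _ _ _ _ mX.
pose mX_pack : {mfun measurableTypeR R >-> borelRn R n.+1} :=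
  HB.pack X mX_mixin.
pose mu : probability (borelRn R n.+1) R := distribution P mX_pack.
have muE (f : borelRn R n.+1 -> \bar R) : measurable_fun setT f ->
    (forall p, 0 <= f p)%E -> (\int[mu]_p f p = \int[P]_t f (X t))%E.
  by move=> mf f0; rewrite ge0_integral_distribution.
pose J L := (L * n.+1)%N.
pose K L t s := (word_kernel (n := n) lambda L (word (code m t) (J L))
  (word (code m s) (J L)))%:E.
have K0 L t s : (0 <= K L t s)%E by rewrite lee_fin word_kernel_ge0.
have mKl L s : measurable_fun setT (K L ^~ s).
  exact: (measurable_fun_word _ (measurable_code m)
    (fun w => (word_kernel lambda L w _)%:E)).
have mKr L : measurable_fun setT (fun s => \int[P]_t K L t s)%E.
  exact: (measurable_fun_word _ (measurable_code m)
    (fun v => \int[P]_t (word_kernel lambda L _ v)%:E)%E).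
(* All words read off [t] and [s] have positive mass, so [mz] gives vectors of norm at most 1 at
   every level; they tend to [X t - X s]. *)
have X1 t s : 0 <= t < 1 -> 0 <= s < 1 -> enorm (X t - X s : 'rV[R]_n.+1) <= 1.
  move=> t01 s01.
  have zP L : exists z : 'rV[R]_n.+1, enorm z <= 1 /\ forall i,
      `|(corner (code m t) L - corner (code m s) L) ord0 i - z ord0 i|
        <= mesh L + mesh L.
    have [||||z z1 zi] := mz L (word (code m t) (J L)) (word (code m s) (J L)).
    - exact: m_code_gt0.
    - exact: m_code_gt0.
    - exact: size_word.
    - exact: size_word.
    exists z; split => // i.
    by rewrite -(corner_letter (code m t)) -(corner_letter (code m s)).
  have [z z_] := choice zP.
  have zX : enorm (z L) @[L --> \oo] --> enorm (X t - X s : 'rV[R]_n.+1).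
    apply: cvg_enorm => i; apply/cvgrPdist_le => eps eps0.
    (* Two meshes come from [mz] and one from each corner to its limit point. *)
    have : (fun L => 4 * mesh L) @ \oo --> (0 : R).
      by rewrite -(mulr0 4); apply: cvgMl_tmp; exact: cvg_mesh.
    move=> /cvgr0_norm_le /(_ _ eps0); apply: filterS => L.
    have := (z_ L).2 i; have := corner_point (R := R) (code m t) L i.
    have := corner_point (R := R) (code m s) L i; have := @mesh_gt0 R L.
    rewrite !mxE !ler_norml => *; lra.
  rewrite -(cvg_lim _ zX)//; apply: limr_le.
    by apply/cvg_ex; eexists; exact: zX.
  by near=> L; have [] := z_ L.
(* An open set around a support point has positive mass, so its preimage cannot lie in the null
   complement of [[0, 1[]. *)
have suppX p (A : set 'rV[R]_n.+1) : supp mu p -> open A -> A p ->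
    exists2 t, 0 <= t < 1 & A (X t).
  move=> pmu oA Ap; apply: contrapT => /forall2NP h.
  have := pmu A oA Ap; rewrite ltNge => /negP; apply.
  pose I01 : set (measurableTypeR R) := [set` `[(0 : R), 1[].
  have mI01 : measurable I01 by exact: measurable_itv.
  have I1 : P I01 = 1%E.
    rewrite [LHS]uniform_prob_sub01//.
      by rewrite lebesgue_measure_itv/= lte_fin ltr01 sube0.
    by move=> x; rewrite /I01 /= !in_itv/= => /andP[-> /ltW ->].
  have mA : measurable (X @^-1` A).
    by rewrite -[X in measurable X]setTI;
      exact: (mX measurableT A (measurable_open oA)).
  have I0 : P (~` I01) = 0%E.
    by rewrite probability_setC// [X in (_ - X)%E]I1 subee.
  have : (P (X @^-1` A) <= P (~` I01))%E.
    apply: le_measure; rewrite ?inE//; first exact: measurableC.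
    by move=> t /= At; rewrite /I01 /= in_itv/= => t01; case: (h t).
  by rewrite I0.
exists mu.
  apply: ge_ereal_sup => _ [p pmu [q qmu <-]]; rewrite lee_fin.
  have open_far (a : 'rV[R]_n.+1) : open [set z | 1 < enorm (z - a)].
    rewrite (_ : [set z | _] =
      (fun z => enorm (z - a)) @^-1` [set r | 1 < r])//.
    apply: open_comp; last exact: open_gt.
    by move=> z _; exact: continuous_enormB.
  have enormC (a a' : 'rV[R]_n.+1) : enorm (a - a') = enorm (a' - a).
    congr Num.sqrt; apply: eq_bigr => i _; rewrite !mxE; ring.
  (* Support points are reached from values of [X] one at a time: first [p] against [X s], then [q]
     against [p]. *)
  have pX s : 0 <= s < 1 -> enorm (p - X s) <= 1.
    move=> s01; rewrite leNgt; apply/negP => far.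
    have [t t01 /=] := suppX p _ pmu (open_far (X s)) far.
    by rewrite ltNge X1.
  rewrite leNgt enormC; apply/negP => far.
  have [t t01 /=] := suppX q _ qmu (open_far p) far.
  by rewrite ltNge enormC pX.
rewrite muE; last 2 first.
- exact: measurable_potential.
- by move=> q; apply: integral_ge0 => p _; exact: riesz_kernel_ge0.
have KE L : (\int[P]_s \int[P]_t K L t s <= e%:E)%E.
  have bm w : size w = J L ->
      P [set t | word (code m t) (J L) = w] = (m w)%:E.
    by move=> <-; exact: prob_word_code.
  rewrite [leLHS](_ : _ =
    (word_energy (J L) (word_kernel (n := n) lambda L) m)%:E).
    by rewrite lee_fin; exact: me.
  exact: (@integral2_word R _ (measurableTypeR R) P (code m) (J L) m
    (word_kernel (n := n) lambda L) (@measurable_code R m) bm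
    (@word_kernel_ge0 R n lambda L)).
(* Fatou for the inner integral; the second use, below, is for the outer one. *)
have potE s : (\int[mu]_p riesz_kernel lambda p (X s) <=
    limn_einf (fun L => \int[P]_t K L t s))%E.
  rewrite muE; last 2 first.
  - exact: measurable_riesz_kernel_l.
  - by move=> p; exact: riesz_kernel_ge0.
  rewrite (_ : (\int[P]_t _ = \int[P]_t limn_einf (fun L => K L t s))%E).
    by apply: fatou => // L; exact: mKl.
  apply: eq_integral => t _.
  by rewrite (cvg_limn_einf_sup (@cvg_word_kernel (code m t) (code m s))).
apply: (@le_trans _ _
  (\int[P]_s limn_einf (fun L => \int[P]_t K L t s))%E).
  apply: ge0_le_integral => //.
  - by move=> s _; apply: integral_ge0 => t _; exact: riesz_kernel_ge0.
  - by apply: (measurableT_comp (measurable_potential lambda mu) mX).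
  - apply: (measurableT_comp (@oppe_measurable R setT)).
    apply: measurable_fun_limn_esup => L.
    exact: (measurableT_comp (@oppe_measurable R setT) (mKr L)).
apply: (le_trans (fatou _ _ _ _)) => //.
  by move=> L s _; apply: integral_ge0.
(* The infimum over each tail is at most its first term, which [KE] bounds by [e]. *)
rewrite limn_einf_lim; apply: lime_le; first exact: is_cvg_einfs.
apply: nearW => L; apply: le_trans (KE L); apply: ereal_inf_lbound.
by exists L => /=.
Unshelve. all: by end_near. Qed.

End limit_law.

(** * Passage to the limit along a minimizing sequence *)

Section existence.
Context {R : realType} {n : nat} (lambda : R) (lambda_gt0 : 0 < lambda).

Lemma energy_ge0 (nu : probability (borelRn R n.+1) R) :
  (0 <= energy lambda nu)%E.
Proof.
rewrite /energy; case: ifP => _; last exact: leey.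
apply: integral_ge0 => q _; apply: integral_ge0 => p _.
exact: riesz_kernel_ge0.
Qed.

Lemma limit_of_energies (nu : nat -> probability (borelRn R n.+1) R) (e : R) :
  (forall k, (energy lambda (nu k) <= (e + k.+1%:R^-1)%:E)%E) ->
  exists mu : probability (borelRn R n.+1) R, (energy lambda mu <= e%:E)%E.
Proof.
move=> nue.
(* A larger diameter would make the energy infinite. *)
have nu1 k : (diam (supp (nu k)) <= 1)%E.
  by have := nue k; rewrite /energy; case: ifP => // _; rewrite leye_eq.
have nuE k : (\int[nu k]_q \int[nu k]_p riesz_kernel lambda p q <=
    (e + k.+1%:R^-1)%:E)%E.
  by have := nue k; rewrite /energy nu1.
have [x xnu] := choice (fun k => supp_nonempty (nu k)).
pose f k := cell_mass (nu k) (x k).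
have [G [m [GG ooG fm]]] :=
  ultralimit (f := f) (fun k w => cell_mass_bounds (nu k) (x k) w).
have meq (u u' : nat -> R) (l l' : R) : u @ G --> l -> u' @ G --> l' ->
    (forall k, u k = u' k) -> l = l'.
  by move=> ul + /funext uu'; rewrite -uu' => ul'; transitivity (lim (u @ G));
    [exact/esym/cvg_lim|exact/cvg_lim].
have m0 w : 0 <= m w.
  have cN : - f k w @[k --> G] --> - m w by apply: cvgN; exact: fm.
  rewrite -oppr_le0; apply: (ultralimit_le GG ooG cN).
  exists 0%N => // k _; rewrite oppr_le0.
  by case/andP: (cell_mass_bounds (nu k) (x k) w).
have m1 : m [::] = 1.
  have c1 : (1 : R) @[_ --> G] --> (1 : R) by exact: cvg_cst.
  by apply: (meq _ _ _ _ (fm [::]) c1) => k; exact: cell_mass_nil.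
have mD w : m (false :: w) + m (true :: w) = m w.
  have cD : f k (false :: w) + f k (true :: w) @[k --> G] -->
      m (false :: w) + m (true :: w) by apply: cvgD; exact: fm.
  by apply: (meq _ _ _ _ cD (fm w)) => k; exact: cell_mass_cons.
have [||mu mu1 muE] := @limit_law R n lambda lambda_gt0 m e m0 m1 mD.
- move=> L; apply/ler_addgt0Pr => eps eps0.
  have cE : word_energy (L * n.+1) (word_kernel (n := n) lambda L) (f k)
      @[k --> G] --> word_energy (L * n.+1) (word_kernel (n := n) lambda L) m.
    apply: (cvg_big (@add_continuous R)) => v _; apply: cvgM; last exact: fm.
    apply: (cvg_big (@add_continuous R)) => w _; apply: cvgM; last exact: fm.
    exact: cvg_cst.
  apply: (ultralimit_le GG ooG cE).
  have := near_infty_natSinv_lt (PosNum eps0); apply: filterS => k /= keps.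
  rewrite -lee_fin.
  apply: le_trans (word_energy_le lambda_gt0 L (nu1 k) (xnu k)) _.
  by apply: le_trans (nuE k) _; rewrite lee_fin lerD2l ltW.
- move=> L w v mw mv wL vL.
  (* If one of the two masses vanished for each [k], their product would be 0 in the limit. A common
     [k] is required because the diameter bound compares two points of one support. *)
  have [k [fw fv]] : exists k, 0 < f k w /\ 0 < f k v.
    apply: contrapT => /forallNP h; have : m w * m v = 0.
      have cM : f k w * f k v @[k --> G] --> m w * m v.
        by apply: cvgM; exact: fm.
      have c0 : (0 : R) @[_ --> G] --> (0 : R) by exact: cvg_cst.
      apply: (meq _ _ _ _ cM c0).
      move=> k; have [fw0 _] := andP (cell_mass_bounds (nu k) (x k) w).
      have [fv0 _] := andP (cell_mass_bounds (nu k) (x k) v).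
      move: fw0 fv0; rewrite -/(f k) !le_eqVlt.
      move=> /orP[/eqP <-|fw0]; first by rewrite mul0r.
      by move=> /orP[/eqP <-|fv0]; [rewrite mulr0|case: (h k)].
    by move/eqP; rewrite mulf_eq0 !gt_eqF.
  have [p <- pnu] := cell_meets_supp fw; have [q <- qnu] := cell_meets_supp fv.
  exists (p - q); first exact: enorm_supp (nu1 k) pnu qnu.
  rewrite wL vL !corner_letter.
  by apply: corner_vdigitB; exact: coord_supp (nu1 k) _ (xnu k).
by exists mu; rewrite /energy mu1.
Qed.

End existence.

Theorem theorem2 (R : realType) (n : nat) (lambda : R)
    (n_ge1 : (1 <= n)%N) (lambda_gt0 : 0 < lambda) (lambda_lt : lambda < n%:R) :
  exists mu : probability (borelRn R n) R,
    forall nu : probability (borelRn R n) R,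
      (energy lambda mu <= energy lambda nu)%E.
Proof.
case: n n_ge1 {lambda_lt} => // n _.
pose E := range (energy lambda : probability (borelRn R n.+1) R -> \bar R).
have infE (nu : probability (borelRn R n.+1) R) :
    (ereal_inf E <= energy lambda nu)%E.
  by apply: ereal_inf_lbound; exists nu.
have inf0 : (0 <= ereal_inf E)%E.
  by apply: le_ereal_inf_tmp => _ [nu _ <-]; exact: energy_ge0.
(* With an infinite infimum all energies are infinite and any measure, here a Dirac mass, is a
   minimizer. *)
have [inf_oo|inf_fin] := eqVneq (ereal_inf E) +oo%E.
  exists (\d_(0 : borelRn R n.+1)) => nu.
  by move: (infE nu); rewrite inf_oo leye_eq => /eqP ->; exact: leey.
have infK : ((fine (ereal_inf E))%:E = ereal_inf E)%E.
  by rewrite fineK// ge0_fin_numE// ltey.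
set e := fine (ereal_inf E) in infK.
have nuP k : exists nu : probability (borelRn R n.+1) R,
    (energy lambda nu <= (e + k.+1%:R^-1)%:E)%E.
  have : (ereal_inf E < (e + k.+1%:R^-1)%:E)%E.
    by rewrite -infK lte_fin ltrDl invr_gt0.
  by move=> /ereal_inf_lt[_ [nu _ <-] /ltW]; exists nu.
have [nu nue] := choice nuP.
have [mu mue] := limit_of_energies lambda_gt0 nue.
by exists mu => eta; apply: le_trans (infE eta); rewrite -infK.
Qed.
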